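(* There is a universal constant $C>0$ such that the following holds. Let $\mathcal X$ be a discrete instance space with unweighted improvement graph $G=(\mathcal X,E)$ having a self-loop at every node and with $|\Delta(x)|\le\Delta_G$ for all $x\in\mathcal X$, let $\mathcal Y=\{z_1,\dots,z_k\}$, $k\ge 2$, with preference order $z_1<\dots<z_k$, and let $\mathcal H\subseteq\mathcal Y^{\mathcal X}$ be nonempty. In the realizable multiclass online learning with improvement game with bandit feedback, the Bandit-to-Full-Feedback Reduction algorithm, given Multiclass ISOA as input, makes at most $C\cdot\Delta_G\cdot\mathrm{ILdim}(\mathcal H)\cdot k\log k$ mistakes. Consequently, the price of bandit feedback is $\mathcal O(\Delta_G\cdot k\log k)$: the optimal mistake bound of deterministic learners with bandit feedback is at most $C\,\Delta_G\,k\log k$ times the optimal mistake bound of deterministic learners with full feedback.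
   Context: Improvement graph: $G=(\mathcal X,E)$ is a directed graph; $\Delta(x)=\{v:(x,v)\in E\}$, $x\in\Delta(x)$ for all $x$. Best response: given $h:\mathcal X\to\mathcal Y$ and $x$, if no $v\in\Delta(x)$ has $h(v)>h(x)$, the agent stays at $x$; otherwise it moves to some $v\in\Delta(x)$ for which $h(v)$ is the most preferred label among $\{h(u):u\in\Delta(x)\}$ (ties broken adversarially). Game: at each round $t=1,2,\dots$: the environment presents $x^{(t)}$; the learner, as a deterministic function of everything observed so far, implements $h^{(t)}:\mathcal X\to\mathcal Y$; the agent best responds, ending at $v^{(t)}\in\Delta(x^{(t)})$; the environment selects $y^{(t)}\in\mathcal Y$; the learner makes a mistake iff $h^{(t)}(v^{(t)})\neq y^{(t)}$. Full feedback: the learner is told whether it made a mistake, and upon a mistake receives $v^{(t)}$ and $y^{(t)}$. Bandit feedback: the learner is told whether it made a mistake, and knows $v^{(t)}$, but not $y^{(t)}$. A run is realizable by $\mathcal H$ if there is $h^*\in\mathcal H$ with $h^*(v^{(t)})=y^{(t)}$ for all $t$; only realizable runs are considered. The optimal mistake bound (for either feedback) is the infimum over deterministic learners of the supremum, over realizable runs, of the number of mistakes. Multiclass ILT: a rooted tree with nodes labeled by elements of $\mathcal X$, each internal node labeled $x$ having exactly the following outgoing edges: two edges labeled $(x,y_1),(x,y_2)$ for some $y_1\ne y_2$; and for each $v\in\Delta(x)\setminus\{x\}$, either one edge labeled $(v,z_1)$, or two edges labeled $(v,y_3),(v,y_4)$ for some $y_3\neq y_4$ in $\mathcal Y\setminus\{z_1\}$.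 Depth is the length of the shortest root-to-leaf branch. A tree is shattered by $\mathcal H$ if for every branch with edge labels $(u_1,y_1),(u_2,y_2),\dots$ some $h\in\mathcal H$ has $h(u_i)=y_i$ for all $i$. $\mathrm{ILdim}(\mathcal H)$ is the maximum depth of a multiclass ILT shattered by $\mathcal H$ ($\infty$ if unbounded, in which case the bounds are vacuous); $\mathrm{ILdim}(\emptyset)=-1$. For $\mathcal V\subseteq\mathcal H$, $\mathcal V_{x,y}=\{h\in\mathcal V:h(x)=y\}$. Multiclass ISOA (a full feedback learner whose state is a version space $\mathcal V$, initially $\mathcal H$): upon receiving $x^{(t)}$, it defines a hypothesis on $\Delta(x^{(t)})$ by the first applicable rule: (i) if some $x'\in\Delta(x^{(t)})$ has $\max_y\mathrm{ILdim}(\mathcal V_{x',y})<\mathrm{ILdim}(\mathcal V)$, label $x'$ by $z_k$ and all other points of $\Delta(x^{(t)})$ by $z_1$; (ii) else if $\arg\max_y\mathrm{ILdim}(\mathcal V_{x^{(t)},y})$ is a unique label $y$, label $x^{(t)}$ by $y$ and all other points of $\Delta(x^{(t)})$ by $z_1$; (iii) else take $x'\in\Delta(x^{(t)})$ for which $\arg\max_y\mathrm{ILdim}(\mathcal V_{x',y})$ is a unique label $y$ and $y\neq z_1$, label $x'$ by $y$ and all other points of $\Delta(x^{(t)})$ by $z_1$. (If $\mathcal V=\emptyset$ or no rule applies, the hypothesis is arbitrary.) Updating the learner with a pair $(v,y)$ replaces $\mathcal V$ by $\mathcal V_{v,y}$. Bandit-to-Full-Feedback Reduction with input a full feedback learner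 $\mathcal A$: maintain a finite collection (with multiplicity) $\mathcal E$ of copies of $\mathcal A$ in various states (''experts'') with weights $w_e>0$; initially $\mathcal E=\{\mathcal A\}$, $w_{\mathcal A}=1$. For $F\subseteq\mathcal E$, $w(F)=\sum_{e\in F}w_e$. At round $t$, upon receiving $x^{(t)}$, write $e(x')$ for the label that the hypothesis of expert $e$ (on input $x^{(t)}$) assigns to $x'\in\Delta(x^{(t)})$, and $\mathcal E_{x',y}=\{e\in\mathcal E:e(x')=y\}$. If some $x'\in\Delta(x^{(t)})$ has $\max_{y\ne z_1}w(\mathcal E_{x',y})\ge\frac{w(\mathcal E)}{k(\Delta_G+1)}$, set $h^{(t)}(x')=\arg\max_{y\neq z_1}w(\mathcal E_{x',y})$ and $h^{(t)}(v)=z_1$ for all other $v\in\Delta(x^{(t)})$; otherwise set $h^{(t)}\equiv z_1$ on $\Delta(x^{(t)})$. If no mistake is made, nothing changes. If a mistake is made: (a) if $h^{(t)}\equiv z_1$ on $\Delta(x^{(t)})$ (so $v^{(t)}=x^{(t)}$), then every $e\in\mathcal E$ with $e(x')=z_1$ for all $x'\in\Delta(x^{(t)})$ is removed and replaced, for each $y\neq z_1$, by the expert $e_y$ obtained by updating $e$ with $(x^{(t)},y)$, with weight $w_{e_y}=\frac{w_e}{2(k-1)}$; (b) otherwise, every $e\in\mathcal E$ with $e(v^{(t)})=h^{(t)}(v^{(t)})$ is removed and replaced, for each $y\neq h^{(t)}(v^{(t)})$, by the expert $e_y$ obtained by updating $e$ with $(v^{(t)},y)$, with weight $w_{e_y}=\frac{w_e}{2(k-1)}$.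 *)

(* Defs.v *)
From mathcomp Require Import all_boot all_order all_algebra.
From mathcomp Require Import all_classical all_reals all_analysis.

Set Implicit Arguments.
Unset Strict Implicit.
Unset Printing Implicit Defensive.

Import Order.TTheory GRing.Theory Num.Theory.
Local Open Scope classical_set_scope.
Local Open Scope ring_scope.

(* Conventions. A set of k >= 2 labels z_1 < ... < z_k is 'I_n.+2, with
   k = n.+2, z_1 = ord0, z_k = ord_max, and preference given by the order on
   nat. The instance space is an arbitrary type X, and the improvement graph
   is given by its edge set E. *)

Section Game.
Variables (X : Type) (E : set (X * X)) (n : nat).
Local Notation Y := 'I_n.+2.
Local Notation z1 := (ord0 : Y).

Definition nbr (x : X) : set X := [set v | E (x, v)].

(* Ties are broken adversarially, so this is a relation in the final
   position v. *)
Definition best_response (h : X -> Y) (x v : X) : Prop :=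
  ((forall u, nbr x u -> ~~ (h x < h u)%N) /\ v = x) \/
  [/\ (exists2 u, nbr x u & (h x < h u)%N), nbr x v &
      forall u, nbr x u -> (h u <= h v)%N].

(* A deterministic learner maps the past observations and the current
   instance to a hypothesis. An observation is the presented instance together
   with the feedback (of type F). Histories list the most recent round first. *)
Definition learner (F : Type) : Type := seq (X * F) -> X -> X -> Y.

(* A feedback rule computes what the learner is told from the position v of
   the agent, the label y, and whether a mistake was made. *)
Definition feedback_rule (F : Type) : Type := X -> Y -> bool -> F.

Definition full_feedback : feedback_rule (option (X * Y)) :=
  fun v y m => if m then Some (v, y) else None.

Definition bandit_feedback : feedback_rule (X * bool) := fun v y m => (v, m).

Record play := Play {
  instance : nat -> X;
  position : nat -> X;
  label : nat -> Y }.

Section Play.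
Variables (F : Type) (fb : feedback_rule F) (L : learner F) (p : play).

Fixpoint history (t : nat) : seq (X * F) :=
  if t is t'.+1 then
    let past := history t' in
    let x := instance p t' in
    let v := position p t' in
    let y := label p t' in
    (x, fb v y (L past x v != y)) :: past
  else [::].

Definition hypothesis_at (t : nat) : X -> Y := L (history t) (instance p t).

Definition mistake_at (t : nat) : bool :=
  hypothesis_at t (position p t) != label p t.

Definition legal_play : Prop :=
  forall t, best_response (hypothesis_at t) (instance p t) (position p t).

End Play.

Definition realizable (H : set (X -> Y)) (p : play) : Prop :=
  exists2 h, H h & forall t, h (position p t) = label p t.

Section MistakeBounds.
Variable R : realType.

Definition num_mistakes F (fb : feedback_rule F) (L : learner F) (p : play) :
    \bar R :=
  counting [set t | mistake_at fb L p t].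

Definition mistake_bound F (fb : feedback_rule F) (H : set (X -> Y))
    (L : learner F) : \bar R :=
  ereal_sup [set num_mistakes fb L p |
             p in [set p | legal_play fb L p /\ realizable H p]].

Definition optimal_mistake_bound F (fb : feedback_rule F)
    (H : set (X -> Y)) : \bar R :=
  ereal_inf [set mistake_bound fb H L | L in [set: learner F]].

End MistakeBounds.

(* In Node x e c, the outgoing edges of the node labeled x are the pairs
   (u, y) with e u y, and the edge (u, y) leads to the subtree c u y; the value
   of c away from e is irrelevant. Labels of leaves play no role and are
   omitted. *)
Inductive tree : Type :=
| Leaf
| Node (x : X) (e : X -> set Y) (c : X -> Y -> tree).

Definition ilt_edges (x : X) (e : X -> set Y) : Prop :=
  [/\ (exists y1 y2, y1 != y2 /\ e x = [set y1; y2]),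
      (forall v, nbr x v -> v <> x ->
         e v = [set z1] \/
         exists y3 y4, [/\ y3 != y4, y3 != z1, y4 != z1 &
                           e v = [set y3; y4]]) &
      (forall v, ~ nbr x v -> e v = set0)].

Fixpoint is_ilt (T : tree) : Prop :=
  if T is Node x e c then
    ilt_edges x e /\ forall u y, e u y -> is_ilt (c u y)
  else True.

Inductive branch : tree -> seq (X * Y) -> Prop :=
| branch_leaf : branch Leaf [::]
| branch_node x e c u y s :
    e u y -> branch (c u y) s -> branch (Node x e c) ((u, y) :: s).

Definition has_depth (T : tree) (d : nat) : Prop :=
  (exists2 s, branch T s & size s = d) /\
  (forall s, branch T s -> (d <= size s)%N).

Definition shattered (V : set (X -> Y)) (T : tree) : Prop :=
  forall s, branch T s ->
    exists2 h, V h & all (fun uy => h uy.1 == uy.2) s.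

Definition restrict (V : set (X -> Y)) (x : X) (y : Y) : set (X -> Y) :=
  [set h | V h /\ h x = y].

(* h labels x' by y and all other points of nbr x by z_1. *)
Definition singles_out (x : X) (h : X -> Y) (x' : X) (y : Y) : Prop :=
  h x' = y /\ forall v, nbr x v -> v <> x' -> h v = z1.

Section ISOA.
Variable R : realType.
Implicit Types (V : set (X -> Y)) (x v : X).

Definition ILdim V : \bar R :=
  if `[< V = set0 >] then (-1)%:E
  else ereal_sup [set d%:R%:E | d in
         [set d | exists T, [/\ is_ilt T, shattered V T & has_depth T d]]].

Definition max_ILdim V x : \bar R :=
  \big[Order.max/-oo%E]_(y : Y) ILdim (restrict V x y).

Definition argmax_ILdim V x : set Y :=
  [set y | ILdim (restrict V x y) = max_ILdim V x].

(* Hypotheses allowed by the ISOA rules for version space V on instance x;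
   only the values on nbr x matter. *)
Definition isoa_rule V x (h : X -> Y) : Prop :=
  let drop x' := nbr x x' /\ (max_ILdim V x' < ILdim V)%E in
  let unique_at x' y := argmax_ILdim V x' = [set y] in
  let forced x' y := [/\ nbr x x', unique_at x' y & y != z1] in
  [/\ ((exists x', drop x') ->
         exists2 x', drop x' & singles_out x h x' ord_max),
      (~ (exists x', drop x') ->
         forall y, unique_at x y -> singles_out x h x y) &
      (~ (exists x', drop x') -> ~ (exists y, unique_at x y) ->
         (exists x' y, forced x' y) ->
         exists x' y, forced x' y /\ singles_out x h x' y)].

(* The rules leave choices open; an implementation is any function of the
   version space and the instance that obeys them. *)
Definition isoa_implementation (f : set (X -> Y) -> X -> X -> Y) : Prop :=
  forall V x, V !=set0 -> isoa_rule V x (f V x).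

End ISOA.

Record full_algorithm := FullAlgorithm {
  state : Type;
  initial_state : state;
  hypothesis : state -> X -> X -> Y;
  update : state -> X -> Y -> state }.

Definition isoa (f : set (X -> Y) -> X -> X -> Y) (H : set (X -> Y)) :
    full_algorithm :=
  @FullAlgorithm (set (X -> Y)) H f restrict.

Section Reduction.
Variables (R : realType) (A : full_algorithm) (D : nat).
Local Notation k := n.+2.

(* A finite collection, with multiplicity, of weighted states of A. *)
Definition experts : Type := seq (state A * R).

Definition total_weight (ex : experts) : R := \sum_(e <- ex) e.2.

Definition vote_weight (ex : experts) (x x' : X) (y : Y) : R :=
  \sum_(e <- ex | hypothesis e.1 x x' == y) e.2.

Definition max_vote (ex : experts) (x x' : X) : R :=
  \big[Order.max/0]_(y : Y | y != z1) vote_weight ex x x' y.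

Definition reduction_rule (ex : experts) (x : X) (h : X -> Y) : Prop :=
  let heavy x' :=
    nbr x x' /\ total_weight ex / (k%:R * D.+1%:R) <= max_vote ex x x' in
  ((exists x', heavy x') ->
     exists x' y, [/\ heavy x', y != z1,
                      vote_weight ex x x' y = max_vote ex x x' &
                      singles_out x h x' y]) /\
  (~ (exists x', heavy x') -> forall v, nbr x v -> h v = z1).

(* The children of e, one for each label other than y0. *)
Definition split_expert (e : state A * R) (v : X) (y0 : Y) : experts :=
  [seq (update e.1 v y, e.2 / (2 * k.-1%:R)) | y <- enum 'I_k & y != y0].

Definition reduction_update (ex : experts) (x : X) (h : X -> Y) (v : X) :
    experts :=
  if `[< forall u, nbr x u -> h u = z1 >] then
    flatten [seq if `[< forall u, nbr x u -> hypothesis e.1 x u = z1 >]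
                 then split_expert e x z1 else [:: e] | e <- ex]
  else
    flatten [seq if hypothesis e.1 x v == h v
                 then split_expert e v (h v) else [:: e] | e <- ex].

Fixpoint reduction_state (L : learner (X * bool))
    (hist : seq (X * (X * bool))) : experts :=
  if hist is (x, (v, mistaken)) :: past then
    let ex := reduction_state L past in
    if mistaken then reduction_update ex x (L past x) v else ex
  else [:: (initial_state A, 1)].

(* L is the bandit learner obtained by running the reduction on A with degree
   bound D, under some resolution of the choices left open. *)
Definition is_reduction (L : learner (X * bool)) : Prop :=
  forall hist x, reduction_rule (reduction_state L hist) x (L hist x).

End Reduction.

End Game.

(* Main.v *)
Require Import Defs.
From mathcomp Require Import all_boot all_order all_algebra.
From mathcomp Require Import all_classical all_reals all_analysis.
From mathcomp Require Import ring zify.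

Set Implicit Arguments.
Unset Strict Implicit.
Unset Printing Implicit Defensive.

Import Order.TTheory GRing.Theory Num.Theory.
Local Open Scope classical_set_scope.
Local Open Scope ring_scope.

(* Let a = 2 (k - 1). A mistake of the reduction halves the weight of a set of
   experts that carries at least a fraction 1 / (k (D + 1)) of the total
   weight, so after m mistakes the total weight is at most
   (1 - 1 / (2 k (D + 1)))^m. On the other hand, an ISOA expert is only updated
   when its hypothesis agrees with the mistaken label, and then every other
   label lowers the ILdim of its version space; hence the sum of
   w_e a^(-ILdim V_e) over the experts whose version space contains the target
   never decreases, and the total weight stays above a^(-ILdim H). Comparing
   logarithms bounds m.
   For the price of bandit feedback, an adversary that walks down a shattered
   tree forces a mistake at every node, so ILdim H is a lower bound for the full
   feedback game. *)

(** * Shattered trees, the dimension [ILdim], and the ISOA rules *)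

Section ILdimTheory.
Variables (R : realType) (X : Type) (E : set (X * X)) (n : nat).
Local Notation Y := 'I_n.+2.
Local Notation z1 := (ord0 : Y).
Implicit Types (V W : set (X -> Y)) (T : tree X n) (d : nat).
Local Notation ILdim := (ILdim E R).

(** Only a lower bound on branch lengths is required, not the exact depth: this is monotone in [d]
    and passes directly from subtrees to their parent. *)
Definition shatters_depth V d : Prop :=
  exists T, [/\ is_ilt E T, shattered V T &
                forall s, branch T s -> (d <= size s)%N].

Lemma branch_leafP (s : seq (X * Y)) : branch (Leaf X n) s -> s = [::].
Proof. by move=> sL; inversion sL. Qed.

Lemma branch_nodeP x e c (s : seq (X * Y)) : branch (Node x e c) s ->
  exists v y s', [/\ s = (v, y) :: s', e v y & branch (c v y) s'].
Proof. by move=> sT; inversion sT; subst; do 3 eexists; split. Qed.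

Lemma ilt_branch T : is_ilt E T -> exists s, branch T s.
Proof.
elim: T => [_|x e c IH /= [[[y1 [y2 [_ ex]]] _ _] Hc]].
  by exists [::]; constructor.
have exy : e x y1 by rewrite ex; left.
by have [s sb] := IH _ _ (Hc _ _ exy); exists ((x, y1) :: s); constructor.
Qed.

(** The tree may branch infinitely, but some branch exists and each is finite, so a shortest one
    exists. *)
Lemma ilt_has_depth T d : is_ilt E T ->
  (forall s, branch T s -> (d <= size s)%N) ->
  exists2 d', (d <= d')%N & has_depth T d'.
Proof.
move=> /ilt_branch[s0 s0T] dT.
have ex : exists m, `[< exists2 s, branch T s & size s = m >].
  by exists (size s0); apply/asboolP; exists s0.
case: (ex_minnP ex) => m /asboolP[s sT sm] minm; exists m.
  by rewrite -sm dT.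
split; first by exists s.
by move=> s' s'T; apply: minm; apply/asboolP; exists s'.
Qed.

Lemma shatters_depth_nonempty V d : shatters_depth V d -> V !=set0.
Proof.
move=> [T [/ilt_branch[s sT] VT _]].
by have [h Vh _] := VT _ sT; exists h.
Qed.

Lemma shatters_depth0 V : V !=set0 -> shatters_depth V 0.
Proof.
move=> [h Vh]; exists (Leaf X n); split=> // s /branch_leafP->.
by exists h.
Qed.

Lemma shatters_depth_le V d d' : (d' <= d)%N ->
  shatters_depth V d -> shatters_depth V d'.
Proof.
move=> dd' [T [Ti VT Td]]; exists T; split=> // s sT.
exact: leq_trans dd' (Td _ sT).
Qed.

Lemma shatters_depth_sub V W d : V `<=` W ->
  shatters_depth V d -> shatters_depth W d.
Proof.
move=> VW [T [Ti VT Td]]; exists T; split=> // s /VT[h Vh hs].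
by exists h => //; apply: VW.
Qed.

Lemma ILdim_set0 : ILdim (set0 : set (X -> Y)) = (-1)%:E.
Proof. by rewrite /Defs.ILdim asboolT. Qed.

Lemma ILdim_nonempty V : V !=set0 -> ILdim V = ereal_sup [set d%:R%:E | d in
  [set d | exists T, [/\ is_ilt E T, shattered V T & has_depth T d]]].
Proof. by move=> /set0P/eqP V0; rewrite /Defs.ILdim asboolF. Qed.

(** Bridge between inequalities in the extended reals and trees; all later dimension arguments go
    through it. *)
Lemma ILdim_geP V d : (d%:R%:E <= ILdim V)%E <-> shatters_depth V d.
Proof.
split=> [|Vd]; last first.
  have V0 := shatters_depth_nonempty Vd; rewrite ILdim_nonempty//.
  have [T [Ti VT Td]] := Vd; have [d' dd' Td'] := ilt_has_depth Ti Td.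
  apply: (@le_trans _ _ d'%:R%:E); first by rewrite lee_fin ler_nat.
  by apply: ereal_sup_ubound; exists d' => //; exists T.
have [->|/set0P V0] := eqVneq V set0.
  by rewrite ILdim_set0 lee_fin => /(le_trans (ler0n _ _)); rewrite lerNr oppr0 ler10.
case: d => [|d]; first by move=> _; exact: shatters_depth0.
rewrite ILdim_nonempty// => dV.
(* The supremum may not be attained, but some tree has depth above [d], and depths are integers. *)
have /ereal_sup_gt[_ [d' [T [Ti VT [_ Td']]] <-]] : (d%:R%:E < ereal_sup
    [set d%:R%:E | d in [set d | exists T, [/\ is_ilt E T, shattered V T & has_depth T d]]] :> \bar R)%E.
  by apply: lt_le_trans dV; rewrite lte_fin ltr_nat.
rewrite lte_fin ltr_nat => dd'.
by exists T; split=> // s /Td'; exact: leq_trans.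
Qed.

Lemma ILdim_le_nat V d : V !=set0 -> ~ shatters_depth V d.+1 ->
  (ILdim V <= d%:R%:E)%E.
Proof.
move=> V0 Vd; rewrite ILdim_nonempty//; apply: ge_ereal_sup.
move=> _ [d' [T [Ti VT [_ Td']]] <-]; rewrite lee_fin ler_nat leqNgt.
by apply/negP => dd'; apply: Vd; apply: shatters_depth_le dd' _; exists T.
Qed.

Lemma ILdim_nat V d : V !=set0 -> ~ shatters_depth V d.+1 ->
  exists2 m, (m <= d)%N & ILdim V = m%:R%:E.
Proof.
move=> V0; elim: d => [|d IH] Vd.
  exists 0 => //; apply/eqP; rewrite eq_le ILdim_le_nat//=.
  by apply/ILdim_geP; exact: shatters_depth0.
have [Vd1|/IH[m md mV]] := pselect (shatters_depth V d.+1).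
  by exists d.+1 => //; apply/eqP; rewrite eq_le ILdim_le_nat//=; apply/ILdim_geP.
by exists m => //; rewrite leqW.
Qed.

Lemma ILdim_ge0 V : V !=set0 -> (0 <= ILdim V)%E.
Proof. by move=> V0; apply/(ILdim_geP V 0); exact: shatters_depth0. Qed.

Lemma ILdim_sub V W : V `<=` W -> (ILdim V <= ILdim W)%E.
Proof.
have [->|/set0P V0] := eqVneq V set0.
  rewrite ILdim_set0 => _; have [->|/set0P W0] := eqVneq W set0.
    by rewrite ILdim_set0.
  by apply: le_trans (ILdim_ge0 W0); rewrite lee_fin lerN10.
move=> VW; rewrite [leLHS]ILdim_nonempty//; apply: ge_ereal_sup.
move=> _ [d [T [Ti VT [_ Td]]] <-]; apply/ILdim_geP.
by apply: shatters_depth_sub VW _; exists T.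
Qed.

Lemma ILdim_infinite_or_nat V : V !=set0 -> ILdim V = +oo%E \/
  exists d, ILdim V = d%:R%:E.
Proof.
move=> V0; have [|/existsNP[d Vd]] := pselect (forall d, shatters_depth V d).
  move=> Vd; left; apply/eqyP => A A0.
  apply: (@le_trans _ _ (Num.truncn A).+1%:R%:E); last exact/ILdim_geP.
  by rewrite lee_fin ltW// truncnS_gt.
right; have [m _ ->] : exists2 m, (m <= d)%N & ILdim V = m%:R%:E; last by exists m.
by apply: ILdim_nat => // /(shatters_depth_le (leqnSn d)).
Qed.

Lemma ILdim_drop V W d : V !=set0 -> ILdim W = d%:R%:E ->
  (ILdim V < ILdim W)%E -> exists2 m, (m < d)%N & ILdim V = m%:R%:E.
Proof.
move=> V0 Wd; have [->|[m ->]] := ILdim_infinite_or_nat V0; first by rewrite ltNge leey.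
by rewrite Wd lte_fin ltr_nat => md; exists m.
Qed.

Lemma max_ILdim_ge V x y : (ILdim (Defs.restrict V x y) <= max_ILdim E R V x)%E.
Proof. by rewrite /max_ILdim; exact: le_bigmax. Qed.

Lemma max_ILdim_le V x : (max_ILdim E R V x <= ILdim V)%E.
Proof.
apply/bigmax_leP; split; first exact: leNye.
by move=> y _; apply: ILdim_sub => h [].
Qed.

Lemma argmax_ILdim_nonempty V x : argmax_ILdim E R V x !=set0.
Proof.
have [y _ ymax] := @eq_bigmax _ _ _ -oo%E (ord0 : Y) xpredT
  (fun y => ILdim (Defs.restrict V x y)) isT (fun _ _ => leNye _).
by exists y.
Qed.

Lemma unique_argmax_drop V x y0 y : argmax_ILdim E R V x = [set y0] ->
  y != y0 -> (ILdim (Defs.restrict V x y) < ILdim V)%E.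
Proof.
move=> uy yy0; apply: lt_le_trans (max_ILdim_le V x).
rewrite lt_neqAle max_ILdim_ge andbT; apply/eqP => ymax.
have : argmax_ILdim E R V x y by [].
by rewrite uy => /eqP; rewrite (negbTE yy0).
Qed.

(* Otherwise the subspaces attaining the maxima all have the dimension of V,
   and hanging their trees below x gives a deeper shattered tree for V. *)
Lemma isoa_rule_applies V x d : nbr E x x -> V !=set0 -> ILdim V = d%:R%:E ->
  ~ (exists x', nbr E x x' /\ (max_ILdim E R V x' < ILdim V)%E) ->
  ~ (exists y, argmax_ILdim E R V x = [set y]) ->
  exists x' y, [/\ nbr E x x', argmax_ILdim E R V x' = [set y] & y != z1].
Proof.
move=> xx V0 Vd nodrop nouniq; apply: contrapT => noforced.
have argmax_deep v y : nbr E x v -> argmax_ILdim E R V v y ->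
    shatters_depth (Defs.restrict V v y) d.
  move=> xv ymax; apply/ILdim_geP; rewrite -Vd ymax leNgt; apply/negP => lt.
  by apply: nodrop; exists v.
have argmax2 v : ~ (exists y, argmax_ILdim E R V v = [set y]) ->
    exists y1 y2, [/\ y1 != y2, argmax_ILdim E R V v y1 & argmax_ILdim E R V v y2].
  move=> nu; have [y1 Ay1] := argmax_ILdim_nonempty V v.
  apply: contrapT => no; apply: nu; exists y1; apply/seteqP; split=> [y2 Ay2|y2 ->//].
  by apply: contrapT => /eqP ne; apply: no; exists y2, y1.
(* All edges carry maximizing labels. At [x] there are two of them. At another neighbour either [z1]
   is a maximizer and gets the single edge, or rule (iii) failing gives two maximizers, both
   different from [z1]. *)
have /choice[e eP] : forall v, exists S : set Y,
    [/\ v = x -> exists y1 y2, y1 != y2 /\ S = [set y1; y2],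
        nbr E x v -> v <> x -> S = [set z1] \/ exists y3 y4,
          [/\ y3 != y4, y3 != z1, y4 != z1 & S = [set y3; y4]],
        ~ nbr E x v -> S = set0 & S `<=` argmax_ILdim E R V v].
  move=> v; have [->|vx] := pselect (v = x).
    have [y1 [y2 [y12 Ay1 Ay2]]] := argmax2 _ nouniq.
    exists [set y1; y2]; split=> //; first by exists y1, y2.
    by move=> _ [->|->].
  have [xv|] := pselect (nbr E x v); last first.
    by move=> xv; exists set0; split.
  have [Az|Az] := pselect (argmax_ILdim E R V v z1).
    by exists [set z1]; split=> // [_ _|_ ->//]; left.
  have [|y3 [y4 [y34 Ay3 Ay4]]] := argmax2 v.
    move=> [y Ay]; apply: noforced; exists v, y; split=> //.
    by apply/eqP => yz; apply: Az; rewrite Ay yz.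
  exists [set y3; y4]; split=> //; last by move=> _ [->|->].
  by move=> _ _; right; exists y3, y4; split=> //; apply/eqP => yz;
    apply: Az; rewrite -yz.
have e_nbr v y : e v y -> nbr E x v.
  move=> evy; have [_ _ e0 _] := eP v; apply: contrapT => /e0 ev0.
  by move: evy; rewrite ev0.
have /choice[c cP] : forall vy, exists T, e vy.1 vy.2 ->
    [/\ is_ilt E T, shattered (Defs.restrict V vy.1 vy.2) T &
        forall s, branch T s -> (d <= size s)%N].
  move=> [v y] /=; have [evy|] := pselect (e v y); last by exists (Leaf X n).
  have [_ _ _ eA] := eP v.
  by have [T ?] := argmax_deep _ _ (e_nbr _ _ evy) (eA _ evy); exists T.
(* The new root adds one edge to branches of length at least [d], contradicting [ILdim V = d]. *)
suff : shatters_depth V d.+1.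
  by move=> /ILdim_geP; rewrite Vd lee_fin ler_nat ltnn.
pose T := Node x e (fun v y => c (v, y)).
exists T; split.
- split.
    split; first by have [/(_ erefl)] := eP x.
      by move=> v; have [] := eP v.
    by move=> v; have [] := eP v.
  by move=> v y evy; have [] := cP (v, y) evy.
- move=> s /branch_nodeP[v [y [s' [-> evy bs']]]].
  have [_ sh _] := cP (v, y) evy; have [h [Vh hv] hs] := sh _ bs'.
  by exists h => //=; rewrite hv eqxx.
- move=> s /branch_nodeP[v [y [s' [-> evy bs']]]].
  by have [_ _ /(_ _ bs')] := cP (v, y) evy.
Qed.

(** The common shape of the three rules. Only rule (ii) can single out a point with label [z1], and
    then the point is [x]. *)
Lemma isoa_rule_singles_out V x d h : nbr E x x -> V !=set0 ->
  ILdim V = d%:R%:E -> isoa_rule E R V x h ->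
  exists x' y', [/\ nbr E x x', singles_out E x h x' y', y' = z1 -> x' = x &
    forall y, y != y' -> (ILdim (Defs.restrict V x' y) < ILdim V)%E].
Proof.
move=> xx V0 Vd [ruleD ruleU ruleF].
have [D|noD] := pselect (exists x', nbr E x x' /\ (max_ILdim E R V x' < ILdim V)%E).
  have [x' [xx' lt] so] := ruleD D; exists x', ord_max; split=> // y _.
  exact: le_lt_trans (max_ILdim_ge _ _ _) lt.
have [[y Uy]|noU] := pselect (exists y, argmax_ILdim E R V x = [set y]).
  exists x, y; split=> //; first exact: ruleU.
  by move=> y'; exact: unique_argmax_drop.
have F := isoa_rule_applies xx V0 Vd noD noU.
have [x' [y [[xx' Uy yz] so]]] := ruleF noD noU F.
exists x', y; split=> // [/eqP|y']; first by rewrite (negbTE yz).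
exact: unique_argmax_drop.
Qed.

(** The condition on [h v = z1] forces [v] to be the singled-out point: elsewhere the label is [z1],
    so [v = x] and [h] is [z1] on the whole neighbourhood, which makes [x] itself the singled-out
    point. *)
Lemma isoa_update_drop V x d h v y : nbr E x x -> V !=set0 ->
  ILdim V = d%:R%:E -> isoa_rule E R V x h -> nbr E x v ->
  (h v = z1 -> v = x /\ forall u, nbr E x u -> h u = z1) -> y != h v ->
  (ILdim (Defs.restrict V v y) < ILdim V)%E.
Proof.
move=> xx V0 Vd hrule xv hv yhv.
have [x' [y' [xx' [hx' hz] y'z drop]]] := isoa_rule_singles_out xx V0 Vd hrule.
have vx' : v = x'.
  apply: contrapT => vx'; have [vx hz1] := hv (hz _ xv vx').
  by apply: vx'; rewrite vx y'z// -hx'; exact: hz1.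
by rewrite vx'; apply: drop; rewrite -hx' -vx'.
Qed.

Definition single_out (x' : X) (y : Y) (u : X) : Y :=
  if `[< u = x' >] then y else z1.

Lemma single_outP x x' y : singles_out E x (single_out x' y) x' y.
Proof.
by split=> [|v _ vx']; rewrite /single_out; [rewrite asboolT|rewrite asboolF].
Qed.

Lemma exists_isoa_rule V x : exists h, isoa_rule E R V x h.
Proof.
have [D|noD] := pselect (exists x', nbr E x x' /\ (max_ILdim E R V x' < ILdim V)%E).
  have [x' dx'] := D; exists (single_out x' ord_max).
  by split=> // _; exists x' => //; exact: single_outP.
have [[y Uy]|noU] := pselect (exists y, argmax_ILdim E R V x = [set y]).
  exists (single_out x y); split=> // [_ y'|_ []]; last by exists y.
  rewrite Uy => /seteqP[/(_ _ erefl) <- _]; exact: single_outP.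
have [[x' [y F]]|noF] := pselect (exists x' y,
    [/\ nbr E x x', argmax_ILdim E R V x' = [set y] & y != z1]).
  exists (single_out x' y); split=> // [_ y' Uy'|_ _ _]; last first.
    by exists x', y; split=> //; exact: single_outP.
  by case: noU; exists y'.
by exists (fun=> z1); split=> // _ y Uy; case: noU; exists y.
Qed.

Lemma exists_isoa_implementation : 
  exists f : set (X -> Y) -> X -> X -> Y, isoa_implementation E R f.
Proof.
have /choice[g gP] : forall Vx : set (X -> Y) * X, exists h,
    isoa_rule E R Vx.1 Vx.2 h by move=> [V x]; exact: exists_isoa_rule.
by exists (fun V x => g (V, x)) => V x _; exact: (gP (V, x)).
Qed.

End ILdimTheory.

(** * Best responses, the tree adversary, and counting mistakes *)

Section Plays.
Variables (X : Type) (E : set (X * X)) (n : nat).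
Local Notation Y := 'I_n.+2.
Local Notation z1 := (ord0 : Y).
Implicit Types (h g : X -> Y) (x v : X).

(** Labels are finitely many, so a most preferred one is attained even on an infinite
    neighbourhood. *)
Lemma exists_best_response h x : exists v, best_response E h x v.
Proof.
have [[u0 xu0 hu0]|no] := pselect (exists2 u, nbr E x u & (h x < h u)%N); last first.
  by exists x; left; split=> // u xu; apply/negP => hu; apply: no; exists u.
have ex : exists m, `[< exists2 u, nbr E x u & h u = m :> nat >].
  by exists (h u0); apply/asboolP; exists u0.
have ub m : `[< exists2 u, nbr E x u & h u = m :> nat >] -> (m <= n.+1)%N.
  by move=> /asboolP[u _ <-]; rewrite -ltnS.
case: (ex_maxnP ex ub) => m /asboolP[v xv hv] maxm.
exists v; right; split=> //; first by exists u0.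
by move=> u xu; rewrite hv; apply: maxm; apply/asboolP; exists u.
Qed.

Lemma best_response_nbr h x v : nbr E x x -> best_response E h x v -> nbr E x v.
Proof. by move=> xx [[_ ->]|[]]. Qed.

Lemma best_response_moved h x v : best_response E h x v -> v <> x -> h v != z1.
Proof.
move=> [[_ ->//]|[[u xu hu] _ hv] _]; apply/eqP => hvz.
by have := leq_trans hu (hv _ xu); rewrite hvz.
Qed.

Lemma best_response_z1 h x v : (forall u, nbr E x u -> h u = z1) ->
  best_response E h x v -> v = x.
Proof. by move=> hz [[]//|[[u xu]]]; rewrite (hz u xu). Qed.

Lemma best_response_singles_out h x v x' y : nbr E x x -> nbr E x x' ->
  y != z1 -> singles_out E x h x' y -> best_response E h x v -> v = x'.
Proof.
move=> xx xx' yz [hx' hz] br; apply: contrapT => vx'.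
have hv := hz _ (best_response_nbr xx br) vx'.
have y0 : (0 < y)%N by rewrite lt0n.
case: br => [[nou vx]|[_ _ hmax]].
  by have := nou _ xx'; rewrite -vx hv hx' y0.
by have := hmax _ xx'; rewrite hv hx' leqNgt y0.
Qed.

Section Constructions.
Variables (F : Type) (fb : feedback_rule X n F).
Implicit Types (L : learner X n F) (p : play X n).

(** Presents [x0] forever and labels by [h]; this continues the adversary's infinite play once a
    leaf is reached. *)
Lemma exists_legal_play L h x0 : exists p, legal_play E fb L p /\
  forall t, h (position p t) = label p t.
Proof.
have /choice[br brP] := fun g => exists_best_response g x0.
pose hist := fun t => iter t (fun past : seq (X * F) => let v := br (L past x0) in
  (x0, fb v (h v) (L past x0 v != h v)) :: past) [::].
pose v t := br (L (hist t) x0).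
pose p := Play (fun _ => x0) v (fun t => h (v t)).
have histE t : history fb L p t = hist t by elim: t => //= t ->.
by exists p; split=> // t; rewrite /hypothesis_at histE; exact: brP.
Qed.

Definition play_cons x v (y : Y) p : play X n := Play
  (fun t => if t is t'.+1 then instance p t' else x)
  (fun t => if t is t'.+1 then position p t' else v)
  (fun t => if t is t'.+1 then label p t' else y).

(** Histories list the latest round first, so a round put before a play lands at the end of each
    history; the learner facing the rest has that observation built in. *)
Lemma hypothesis_at_play_cons L x v y p t :
  hypothesis_at fb L (play_cons x v y p) t.+1 =
  hypothesis_at fb
    (fun past => L (rcons past (x, fb v y (L [::] x v != y)))) p t.
Proof.
rewrite /hypothesis_at; congr (L _ _).
by elim: t => //= t IH; rewrite IH.
Qed.

(** The adversary presents the node label, then follows an edge at the agent's position whose label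
    contradicts the learner; shattering keeps the play realizable. *)
Lemma exists_mistakes_of_tree (T : tree X n) (V : set (X -> Y)) L x0 d :
  (forall x, nbr E x x) -> is_ilt E T -> shattered V T ->
  (forall s, branch T s -> (d <= size s)%N) ->
  exists p, [/\ legal_play E fb L p, realizable V p &
                forall t, (t < d)%N -> mistake_at fb L p t].
Proof.
move=> Exx; elim: T V L d => [|x e c IH] V L d.
  move=> _ VT dT; have [h Vh _] := VT _ (branch_leaf X n).
  have [p [lp hp]] := exists_legal_play L h x0; exists p; split=> //.
    by exists h.
  by move=> t; rewrite ltnNge (leq_trans (dT _ (branch_leaf X n))).
move=> /= [[[y1 [y2 [y12 ex]]] enbr _] ci] VT dT.
have [v br] := exists_best_response (L [::] x) x.
(* Of two labels at least one is wrong for the learner. A lone edge [z1] occurs only where the agent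
   has moved, and an agent never moves to a point labelled [z1]. *)
have [y evy hvy] : exists2 y, e v y & L [::] x v != y.
  have two a b : a != b -> e v = [set a; b] -> exists2 y, e v y & L [::] x v != y.
    move=> ab ->; have [hva|hva] := eqVneq (L [::] x v) a.
      by exists b; [right|rewrite hva].
    by exists a; [left|].
  have [vx|vx] := pselect (v = x); first by apply: (two y1 y2); rewrite ?vx.
  have [ev|[y3 [y4 [y34 _ _ ev]]]] := enbr _ (best_response_nbr (Exx x) br) vx.
    exists z1; first by rewrite ev.
    exact: best_response_moved br vx.
  exact: (two y3 y4).
pose L' past := L (rcons past (x, fb v y (L [::] x v != y))).
have [|||p [lp [h [Vh hv] hp] mp]] := IH v y (Defs.restrict V v y) L' d.-1.
- exact: ci.
- move=> s bs; have [h Vh /= /andP[/eqP hv hs]] := VT _ (branch_node x evy bs).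
  by exists h.
- move=> s bs; have := dT _ (branch_node x evy bs).
  by case: (d).
exists (play_cons x v y p); split.
- case=> [|t]; first exact: br.
  by rewrite hypothesis_at_play_cons; exact: lp.
- by exists h => // -[|t] /=.
- move=> [_|t td]; first exact: hvy.
  rewrite /mistake_at hypothesis_at_play_cons; apply: mp.
  by case: (d) td.
Qed.

End Constructions.

Section Counting.
Variables (R : realType) (F : Type) (fb : feedback_rule X n F).
Variables (L : learner X n F) (p : play X n).
Local Notation mistakes N := (\sum_(0 <= t < N) mistake_at fb L p t)%N.

(** The counting measure is a series of Dirac masses; its partial sums count the mistakes of a
    finite prefix. *)
Let counting_mistakes N : (\sum_(0 <= t < N)
  \d_t [set t | mistake_at fb L p t] = (mistakes N)%:R%:E :> \bar R)%E.
Proof.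
rewrite natr_sum -sumEFin; apply: eq_bigr => t _.
rewrite diracE; have [m|/negP m] := boolP (mistake_at _ _ _ _).
  by rewrite mem_set.
by rewrite memNset.
Qed.

Lemma num_mistakes_ge N : ((mistakes N)%:R%:E <= num_mistakes R fb L p)%E.
Proof.
rewrite -counting_mistakes /num_mistakes counting_dirac.
exact: nneseries_lim_ge.
Qed.

Lemma num_mistakes_le (B : \bar R) :
  (forall N, ((mistakes N)%:R%:E <= B)%E) -> (num_mistakes R fb L p <= B)%E.
Proof.
move=> mB; rewrite /num_mistakes counting_dirac.
apply: lime_le; first exact: is_cvg_nneseries.
by apply: nearW => N; rewrite counting_mistakes.
Qed.

End Counting.

Lemma ILdim_le_mistake_bound (R : realType) (F : Type)
    (fb : feedback_rule X n F) (H : set (X -> Y)) (L : learner X n F) (x0 : X) :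
  (forall x, nbr E x x) -> H !=set0 ->
  (ILdim E R H <= mistake_bound E R fb H L)%E.
Proof.
move=> Exx H0; rewrite ILdim_nonempty//; apply: ge_ereal_sup.
move=> _ [d [T [Ti HT [_ Td]]] <-].
have [p [lp rp mp]] := exists_mistakes_of_tree fb L x0 Exx Ti HT Td.
apply: (@le_trans _ _ (num_mistakes R fb L p)); last first.
  by apply: ereal_sup_ubound; exists p.
apply: le_trans (num_mistakes_ge R fb L p d); rewrite lee_fin ler_nat.
rewrite -[leqLHS]subn0 -[leqLHS]muln1 -sum_nat_const_nat !big_mkord.
by apply: leq_sum => t _; rewrite mp.
Qed.

End Plays.

Lemma ler_sum_all (R : numDomainType) (T : Type) (P : pred T) (s : seq T) (F G : T -> R) :
  all P s -> (forall i, P i -> F i <= G i) ->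
  \sum_(i <- s) F i <= \sum_(i <- s) G i.
Proof.
move=> + FG; elim: s => [|i s IH] /=; first by rewrite !big_nil.
by case/andP=> Pi /IH sFG; rewrite !big_cons lerD// FG.
Qed.

(** * Weight lost by the experts in one mistake of the reduction *)

Section Reduction.
Variables (R : realType) (X : Type) (E : set (X * X)) (n : nat).
Variables (A : full_algorithm X n) (D : nat).
Local Notation Y := 'I_n.+2.
Local Notation z1 := (ord0 : Y).
Local Notation k := n.+2.
Local Notation experts := (@experts X n R A).
Implicit Types (ex : experts) (h : X -> Y) (x v : X).

Definition nonneg_weights ex : bool := all (fun e => 0 <= e.2) ex.

Lemma total_weight_ge0 ex : nonneg_weights ex -> 0 <= total_weight ex.
Proof.
move=> ex0; apply: le_trans (ler_sum_all (F := fun=> 0) ex0 _) => //.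
by rewrite big1.
Qed.

Lemma total_weight_split_expert (e : state A * R) v y0 :
  \sum_(e' <- split_expert e v y0) e'.2 = e.2 / 2.
Proof.
rewrite /split_expert big_map big_filter big_enum_cond/= sumr_const.
have -> : #|[pred y | y != y0]| = n.+1 by rewrite (cardC1 y0) card_ord.
rewrite -[LHS]mulr_natr invfM -!mulrA mulVf ?mulr1//.
Qed.

(** The experts replaced by an update, in cases (a) and (b) alike. *)
Definition refined x h v (e : state A * R) : bool :=
  if `[< forall u, nbr E x u -> h u = z1 >]
  then `[< forall u, nbr E x u -> hypothesis e.1 x u = z1 >]
  else hypothesis e.1 x v == h v.

(** Provides the side condition under which an ISOA update lowers the dimension. *)
Lemma refinedP x h v e : nbr E x x -> best_response E h x v -> refined x h v e ->
  hypothesis e.1 x v = h v /\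
  (h v = z1 -> v = x /\ forall u, nbr E x u -> hypothesis e.1 x u = z1).
Proof.
move=> xx br; rewrite /refined; case: asboolP => [hz /asboolP ez|hz /eqP ->].
  have vx := best_response_z1 hz br; split=> //.
  by rewrite vx ez// hz.
(* A best response labelled [z1] means that no neighbour has a better label, so [h] would be
   constantly [z1]: that is case (a). *)
split=> // hvz; exfalso; apply: hz => u xu.
case: br => [[nou vx]|[[w xw hw] _ hmax]].
  by apply/val_inj/eqP; rewrite -leqn0 /= leqNgt -{1}[0%N]/(val z1) -hvz vx; exact: nou.
by have := leq_trans hw (hmax _ xw); rewrite hvz.
Qed.

Lemma reduction_updateE ex x h v : nbr E x x -> best_response E h x v ->
  reduction_update E ex x h v =
  flatten [seq if refined x h v e then split_expert e v (h v) else [:: e] | e <- ex].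
Proof.
move=> xx br; rewrite /reduction_update /refined; case: asboolP => // hz.
by rewrite (best_response_z1 hz br) hz.
Qed.

Lemma sum_reduction_update (F : state A * R -> R) ex x h v :
  nbr E x x -> best_response E h x v ->
  \sum_(e <- reduction_update E ex x h v) F e =
  \sum_(e <- ex) if refined x h v e
                 then \sum_(e' <- split_expert e v (h v)) F e' else F e.
Proof.
move=> xx br; rewrite reduction_updateE// big_flatten big_map.
by apply: eq_bigr => e _; case: ifP => // _; rewrite big_seq1.
Qed.

Lemma nonneg_weights_update ex x h v :
  nonneg_weights ex -> nonneg_weights (reduction_update E ex x h v).
Proof.
have nonneg_split (P : pred (state A * R)) v' y : nonneg_weights ex ->
    nonneg_weights (flatten
      [seq if P e then split_expert e v' y else [:: e] | e <- ex]).
  rewrite /nonneg_weights; elim: ex => //= e ex' IH /andP[e0 /IH ex0].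
  rewrite all_cat ex0 andbT.
  case: ifP => [_|_ /=]; last by rewrite e0.
  by rewrite all_map; apply/allP => y' _ /=; rewrite divr_ge0// mulr_ge0.
by rewrite /reduction_update; case: ifP => _; exact: nonneg_split.
Qed.

Lemma total_weight_update ex x h v : nbr E x x -> best_response E h x v ->
  total_weight (reduction_update E ex x h v) =
  total_weight ex - (\sum_(e <- ex | refined x h v e) e.2) / 2.
Proof.
move=> xx br; rewrite /total_weight sum_reduction_update// mulr_suml.
rewrite [X in _ - X]big_mkcond -sumrB; apply: eq_bigr => e _.
case: ifP => _; last by rewrite subr0.
by rewrite total_weight_split_expert; field.
Qed.

(** Enumerates the neighbourhood with repetitions, indices outside the range of the injection going
    to [x], so that a union bound becomes a sum over ['I_D]. *)
Lemma card_le_ord_surj x : nbr E x x -> (nbr E x #<= `I_D)%card ->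
  exists g : 'I_D -> X, (forall i, nbr E x (g i)) /\
                        (forall v, nbr E x v -> exists i, g i = v).
Proof.
move=> xx /pcard_leP[f].
have /choice[g gP] : forall i : 'I_D, exists v, nbr E x v /\
    ((exists2 u, nbr E x u & f u = i) -> f v = i).
  move=> i; have [[u xu fu]|no] := pselect (exists2 u, nbr E x u & f u = i :> nat).
    by exists u.
  by exists x.
exists g; split=> [i|v xv]; first by have [] := gP i.
have fvD : (f v < D)%N by have := 'funS_f; apply.
exists (Ordinal fvD); have [xg fg] := gP (Ordinal fvD).
have := 'inj_f; apply; rewrite ?inE//.
by apply: fg; exists v.
Qed.

Lemma degree_gt0 x : nbr E x x -> (nbr E x #<= `I_D)%card -> (0 < D)%N.
Proof.
move=> xx; rewrite lt0n; apply: contraTneq => ->; apply/negP.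
by rewrite II0 => /card_le0P/seteqP[/(_ _ xx)].
Qed.

Lemma vote_weight_le_max ex x x' y : y != z1 ->
  vote_weight ex x x' y <= max_vote ex x x'.
Proof.
by move=> yz; rewrite /max_vote; exact: (le_bigmax_cond _ (vote_weight ex x x')).
Qed.

(** Union bound: an expert that is not constantly [z1] votes for some other label at some
    neighbour. *)
Lemma unrefined_weight_le ex x (g : 'I_D -> X) : nonneg_weights ex ->
  (forall v, nbr E x v -> exists i, g i = v) ->
  \sum_(e <- ex | ~~ `[< forall u, nbr E x u -> hypothesis e.1 x u = z1 >]) e.2 <=
  \sum_(i < D) \sum_(y | y != z1) vote_weight ex x (g i) y.
Proof.
move=> ex0 gs; have -> : \sum_(i < D) \sum_(y | y != z1) vote_weight ex x (g i) y =
    \sum_(e <- ex) \sum_(i < D) \sum_(y | y != z1)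
      if hypothesis e.1 x (g i) == y then e.2 else 0.
  rewrite [RHS]exchange_big/=; apply: eq_bigr => i _.
  by rewrite [RHS]exchange_big/=; apply: eq_bigr => y _; rewrite -big_mkcond.
rewrite big_mkcond/=; apply: ler_sum_all ex0 _ => e e0.
have ge0 (i : 'I_D) (y : Y) : 0 <= if hypothesis e.1 x (g i) == y then e.2 else 0.
  by case: ifP.
case: ifPn => [/asboolPn/existsNP[u /not_implyP[xu /eqP euz]]|_]; last first.
  by apply: sumr_ge0 => i _; apply: sumr_ge0 => y _; exact: ge0.
have [i giu] := gs _ xu.
rewrite (bigD1 i)//= (bigD1 (hypothesis e.1 x u))//= giu eqxx -addrA lerDl.
by apply: addr_ge0; apply: sumr_ge0 => *; [rewrite -giu|apply: sumr_ge0 => *]; exact: ge0.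
Qed.

(** With a heavy vote, the agent is drawn to the chosen point and the refined experts are those
    voters. Otherwise each of the at most [D (k - 1)] votes is light, so the experts constantly [z1]
    keep enough weight. *)
Lemma refined_weight_ge ex x h v : nbr E x x -> (nbr E x #<= `I_D)%card ->
  nonneg_weights ex -> reduction_rule E D ex x h -> best_response E h x v ->
  total_weight ex / (k%:R * D.+1%:R) <= \sum_(e <- ex | refined x h v e) e.2.
Proof.
move=> xx xD ex0 [heavyP lightP] br.
have [hv|nohv] := pselect (exists x', nbr E x x' /\
    total_weight ex / (k%:R * D.+1%:R) <= max_vote ex x x').
  have [x' [y [[xx' le] yz vy so]]] := heavyP hv.
  have vx' := best_response_singles_out xx xx' yz so br.
  rewrite /refined asboolF; last first.
    by have [hx' _] := so => hz; move: yz; rewrite -hx' hz ?eqxx.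
  by rewrite vx'; case: so => -> _; move: vy; rewrite /vote_weight => ->.
have hz := lightP nohv.
have [g [xg gs]] := card_le_ord_surj xx xD.
rewrite /refined asboolT//.
have := unrefined_weight_le ex0 gs.
set t := _ / _; set W0 := \sum_(e <- ex | `[< _ >]) _; set W1 := \sum_(e <- ex | _) _ => W1le.
have WE : total_weight ex = W0 + W1.
  by rewrite /total_weight (bigID (fun e => `[< forall u, nbr E x u -> hypothesis e.1 x u = z1 >])).
have t0 : 0 <= t by rewrite divr_ge0 ?total_weight_ge0.
have tE : total_weight ex = (k%:R * D.+1%:R) * t.
  by rewrite /t mulrC divfK// mulf_neq0 ?pnatr_eq0.
have {}W1le : W1 <= D%:R * (n.+1%:R * t).
  have -> : D%:R * (n.+1%:R * t) = \sum_(i < D) \sum_(y : Y | y != z1) t.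
    by rewrite !sumr_const (cardC1 z1) !card_ord !mulr_natl.
  apply: le_trans W1le _; apply: ler_sum => i _; apply: ler_sum => y yz.
  apply: le_trans (vote_weight_le_max _ _ _ yz) _.
  by rewrite leNgt; apply/negP => /ltW lt; apply: nohv; exists (g i).
have -> : W0 = total_weight ex - W1 by rewrite WE addrK.
(* With [t] the threshold, this reduces to [1 + D (k - 1) <= k (D + 1)]. *)
rewrite lerBrDr tE; apply: le_trans (lerD (lexx t) W1le) _.
rewrite mulrA -!natrM -[X in X + _]mul1r -mulrDl ler_wpM2r// nat1r ler_nat.
nia.
Qed.

End Reduction.

(** * Existence of the reduction, and its weight and potential invariants *)

Section ReductionBound.
Variables (R : realType) (X : Type) (E : set (X * X)) (n D : nat).
Variable A : full_algorithm X n.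
Local Notation Y := 'I_n.+2.
Local Notation z1 := (ord0 : Y).
Local Notation k := n.+2.
Local Notation experts := (@experts X n R A).
Implicit Types (ex : experts) (h : X -> Y) (x v : X).

Lemma vote_weight_ge0 ex x x' y : nonneg_weights ex -> 0 <= vote_weight ex x x' y.
Proof.
move=> ex0; rewrite /vote_weight big_mkcond.
apply: le_trans (ler_sum_all (F := fun=> 0) ex0 _); first by rewrite big1.
by move=> e e0; case: ifP.
Qed.

Lemma exists_reduction_rule ex x : nonneg_weights ex ->
  exists h, reduction_rule E D ex x h.
Proof.
move=> ex0; have [[x' hx']|no] := pselect (exists x', nbr E x x' /\
    total_weight ex / (k%:R * D.+1%:R) <= max_vote ex x x').
  (* The default 0 in [max_vote] is harmless because votes are nonnegative, so the maximum is
     attained by a label. *)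
  have [y yz ymax] := @eq_bigmax _ _ _ 0 (ord_max : Y) (fun y => y != z1)
    (vote_weight ex x x') isT (fun y _ => vote_weight_ge0 x x' y ex0).
  exists (single_out x' y); split; last by case; exists x'.
  by move=> _; exists x', y; split=> //; exact: single_outP.
by exists (fun=> z1); split.
Qed.

Lemma exists_reduction : exists L, is_reduction E R A D L.
Proof.
have /choice[g gP] : forall ex_x : experts * X, exists h,
    nonneg_weights ex_x.1 -> reduction_rule E D ex_x.1 ex_x.2 h.
  move=> [ex x] /=; have [ex0|//] := boolP (nonneg_weights ex); last first.
    by exists (fun=> z1).
  by have [h hP] := exists_reduction_rule x ex0; exists h.
(* Learner and expert state refer to each other; the state is built first from the choice function
   [g], and the learner is read off from it. *)
pose st := fix st (hist : seq (X * (X * bool))) : experts :=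
  if hist is (x, (v, m)) :: past then
    if m then reduction_update E (st past) x (g (st past, x)) v else st past
  else [:: (initial_state A, 1)].
pose L hist x := g (st hist, x).
have stE hist : reduction_state E R A L hist = st hist.
  by elim: hist => //= -[x [v m]] past ->.
have st0 hist : nonneg_weights (st hist).
  elim: hist => [|[x [v [|]]] past IH] /=; rewrite ?ler01//.
  exact: nonneg_weights_update.
by exists L => hist x; rewrite stE; exact: (gP (st hist, x) (st0 hist)).
Qed.

Variables (L : learner X n (X * bool)) (p : play X n) (target : X -> Y).
Hypothesis Exx : forall x, nbr E x x.
Hypothesis ED : forall x, (nbr E x #<= `I_D)%card.
Hypothesis redL : is_reduction E R A D L.
Hypothesis legal_p : legal_play E (@bandit_feedback X n) L p.
Hypothesis target_p : forall t, target (position p t) = label p t.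

(** An abstract form of a^(-ILdim V_e), to be 0 for experts that have lost the target. *)
Variable phi : state A -> R.
Hypothesis phi_ge0 : forall s, 0 <= phi s.
Hypothesis phi_le1 : forall s, phi s <= 1.
Hypothesis phi_update : forall s x v, nbr E x v ->
  (hypothesis s x v = z1 ->
     v = x /\ forall u, nbr E x u -> hypothesis s x u = z1) ->
  target v != hypothesis s x v ->
  phi s <= phi (update s v (target v)) / (2 * n.+1%:R).

Let potential ex := \sum_(e <- ex) e.2 * phi e.1.

(** The child updated with the true label alone makes up for its parent; the other children
    contribute nonnegative terms. *)
Lemma potential_update ex x h v : nonneg_weights ex -> best_response E h x v ->
  target v != h v -> potential ex <= potential (reduction_update E ex x h v).
Proof.
move=> ex0 br tv; rewrite /potential sum_reduction_update//.
apply: ler_sum_all ex0 _ => e e0; case: ifP => // rf.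
have [hev hez] := refinedP (Exx x) br rf.
rewrite big_map big_filter big_enum_cond/= (bigD1 (target v))//=.
apply: (@le_trans _ _ (e.2 / (2 * n.+1%:R) * phi (update e.1 v (target v)))).
  rewrite mulrAC -mulrA ler_wpM2l//; apply: phi_update.
  - exact: best_response_nbr br.
  - by rewrite hev.
  - by rewrite hev.
by rewrite lerDl; apply: sumr_ge0 => y _; rewrite mulr_ge0// divr_ge0// mulr_ge0.
Qed.

Local Notation mistakes N :=
  (\sum_(0 <= t < N) mistake_at (@bandit_feedback X n) L p t)%N.
Local Notation decay := (1 - (2 * (k%:R * D.+1%:R))^-1 : R).

Lemma reduction_invariant N :
  let ex := reduction_state E R A L (history (@bandit_feedback X n) L p N) in
  [/\ nonneg_weights ex, phi (initial_state A) <= potential ex &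
      total_weight ex <= decay ^+ mistakes N].
Proof.
elim: N => [|N [ex0 phiex wex]] /=.
  by rewrite /potential /total_weight !big_seq1 big_geq// expr0 mul1r /= ler01.
rewrite big_nat_recr//=; case: ifPn => m; last first.
  by rewrite /mistake_at /hypothesis_at (negbTE m) addn0.
rewrite {2}/mistake_at /hypothesis_at m.
set ex := reduction_state _ _ _ _ _ in ex0 phiex wex *.
set x := instance p N in m *; set v := position p N in m *.
have br := legal_p N; rewrite /hypothesis_at -/x -/v in br.
split; first exact: nonneg_weights_update.
  by apply: le_trans phiex _; apply: potential_update => //;
    rewrite eq_sym target_p.
rewrite total_weight_update// addn1 exprS.
have ge := refined_weight_ge (Exx x) (ED x) ex0 (redL _ _) br.
set k1 := k%:R * D.+1%:R in ge *.
(* Half of the refined weight is lost, that is, at least a fraction [1 / (2 k1)] of the total. *)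
apply: (@le_trans _ _ (decay * total_weight ex)).
  rewrite mulrBl mul1r lerB// invfM -mulrA [_^-1 * _]mulrC ler_wpM2r// mulrC.
  exact: ge.
rewrite ler_wpM2l// subr_ge0 invf_le1 ?mulr_gt0//.
by rewrite -!natrM ler1n.
Qed.

Lemma initial_potential_le N : phi (initial_state A) <= decay ^+ mistakes N.
Proof.
have [ex0 phiex wex] := reduction_invariant N.
apply: le_trans phiex (le_trans _ wex).
by apply: ler_sum_all ex0 _ => e e0; rewrite ler_piMr.
Qed.

End ReductionBound.

(** * Numerical bound and its application to ISOA *)

Section ISOAReduction.
Variable R : realType.

Lemma mistakes_le_of_decay (n D d m : nat) : (0 < D)%N ->
  (2 * n.+1%:R)^-1 ^+ d <= (1 - (2 * (n.+2%:R * D.+1%:R))^-1) ^+ m :> R ->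
  m%:R <= 8 * D%:R * (n.+2%:R * ln n.+2%:R) * d%:R :> R.
Proof.
move=> D0 le.
set a : R := 2 * n.+1%:R in le; set c : R := 2 * (n.+2%:R * D.+1%:R) in le.
have a0 : 0 < a by rewrite mulr_gt0.
have c1 : 1 <= c by rewrite /c -!natrM ler1n.
have c0 : 0 < c by exact: lt_le_trans c1.
have lnk : 0 <= ln n.+2%:R :> R by rewrite ln_ge0// ler1n.
have {}le : m%:R <= c * (ln a * d%:R).
  (* Logarithms are compared by exponentiating, with [1 - 1/c <= exp (- 1/c)]. *)
  rewrite mulrC -ler_pdivrMr// -lerN2 -ler_expR.
  have -> : expR (- (ln a * d%:R)) = a^-1 ^+ d.
    by rewrite expRN expRM_natr lnK ?posrE// exprVn.
  apply: le_trans le _; have -> : - (m%:R / c) = - c^-1 * m%:R by rewrite mulNr mulrC.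
  have decay0 : 0 <= 1 - c^-1 by rewrite subr_ge0 invf_le1.
  by rewrite expRM_natr lerXn2r ?nnegrE ?expR_ge0// expR_ge1Dx.
(* Because [2 (k - 1) <= k^2]. *)
have lna : ln a <= 2 * ln n.+2%:R.
  have -> : 2 * ln n.+2%:R = ln (n.+2%:R ^+ 2) :> R by rewrite lnXn// mulr_natl.
  rewrite ler_ln ?posrE ?exprn_gt0// /a -natrM -natrX ler_nat; nia.
apply: le_trans le _.
apply: (@le_trans _ _ (c * (2 * ln n.+2%:R * d%:R))).
  by rewrite ler_wpM2l ?ler_wpM2r// ltW.
(* The constant 8 is 2 from [c], 2 from [ln a] and 2 from [D + 1 <= 2 D]. *)
have -> : 8 * D%:R * (n.+2%:R * ln n.+2%:R) * d%:R =
    2 * (n.+2%:R * (2 * D%:R)) * (2 * ln n.+2%:R * d%:R) :> R by ring.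
rewrite ler_wpM2r ?mulr_ge0// /c -!natrM ler_nat; nia.
Qed.

Variables (X : Type) (E : set (X * X)) (n D : nat).
Local Notation Y := 'I_n.+2.
Variables (H : set (X -> Y)) (f : set (X -> Y) -> X -> X -> Y).

(* Lower bound on the factor by which the weight of an expert with version
   space V is still reduced along its descendants updated with correct labels:
   each update costs 1 / (2 * (k - 1)) and lowers ILdim V. *)
Definition version_potential (target : X -> Y) (V : set (X -> Y)) : R :=
  if `[< V target /\ V `<=` H >]
  then (2 * n.+1%:R)^-1 ^+ Num.truncn (fine (ILdim E R V)) else 0.

Lemma isoa_mistakes_le d (L : learner X n (X * bool)) (p : play X n) N :
  (forall x, nbr E x x) -> (forall x, (nbr E x #<= `I_D)%card) ->
  ILdim E R H = d%:R%:E -> isoa_implementation E R f ->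
  is_reduction E R (isoa f H) D L ->
  legal_play E (@bandit_feedback X n) L p -> realizable H p ->
  (\sum_(0 <= t < N) mistake_at (@bandit_feedback X n) L p t)%N%:R <=
    8 * D%:R * (n.+2%:R * ln n.+2%:R) * d%:R :> R.
Proof.
move=> Exx ED Hd fI redL lp [g Hg gp].
have D0 : (0 < D)%N by exact: degree_gt0 (Exx (instance p 0)) (ED _).
have b0 : 0 <= (2 * n.+1%:R)^-1 :> R by rewrite invr_ge0 mulr_ge0.
have b1 : (2 * n.+1%:R)^-1 <= 1 :> R.
  by rewrite invf_le1 ?mulr_gt0// -natrM ler1n.
apply: mistakes_le_of_decay => //.
have -> : (2 * n.+1%:R)^-1 ^+ d = version_potential g H :> R.
  by rewrite /version_potential asboolT; [rewrite Hd /= natrK|split].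
apply: (@initial_potential_le R X E n D (isoa f H) L p g Exx ED redL lp gp).
- by move=> V; rewrite /version_potential; case: ifP => // _; rewrite exprn_ge0.
- by move=> V; rewrite /version_potential; case: ifP => // _; rewrite exprn_ile1.
move=> V x v xv /= hz gv; rewrite {1}/version_potential.
case: asboolP => [[Vg VH]|_]; last first.
  by rewrite divr_ge0 ?mulr_ge0// /version_potential; case: ifP => // _; rewrite exprn_ge0.
have V0 : V !=set0 by exists g.
(* Finiteness is inherited from [H], which is why the potential asks for [V] inside [H]. *)
have [m Vm] : exists m, ILdim E R V = m%:R%:E.
  have [Voo|//] := ILdim_infinite_or_nat R E V0.
  by have := ILdim_sub R E VH; rewrite Voo Hd leye_eq.
have Vg' : Defs.restrict V v (g v) g by [].
have lt := isoa_update_drop (Exx x) V0 Vm (fI V x V0) xv hz gv.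
have [|m' m'm V'm'] := ILdim_drop _ Vm lt; first by exists g.
rewrite /version_potential asboolT; last by split=> // h [/VH].
(* The dimension falls by at least one, which pays for the factor [1 / (2 (k - 1))], as the base is
   at most 1. *)
rewrite Vm V'm' /= !natrK -exprSr; exact: ler_wiXn2l.
Qed.

End ISOAReduction.

Theorem lemma3 (R : realType) :
  exists C : R, 0 < C /\
  forall (X : Type) (E : set (X * X)) (D : nat) (n : nat)
         (H : set (X -> 'I_n.+2)),
    (forall x, nbr E x x) ->
    (forall x, (nbr E x #<= `I_D)%card) ->
    H !=set0 ->
    let k := n.+2 in
    let c : R := C * D%:R * (k%:R * ln k%:R) in
    (forall (f : set (X -> 'I_n.+2) -> X -> X -> 'I_n.+2)
            (L : learner X n (X * bool)),
        isoa_implementation E R f ->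
        is_reduction E R (isoa f H) D L ->
        (mistake_bound E R (@bandit_feedback X n) H L <= c%:E * ILdim E R H)%E)
    /\
    (optimal_mistake_bound E R (@bandit_feedback X n) H
       <= c%:E * optimal_mistake_bound E R (@full_feedback X n) H)%E.
Proof.
exists 8; split=> // X E D n H Exx ED H0 k c.
have lnk : 0 < ln k%:R :> R by rewrite ln_gt0// ltr1n.
have c0 : 0 <= c by rewrite /c !mulr_ge0// ltW.
have upper f L : isoa_implementation E R f -> is_reduction E R (isoa f H) D L ->
    (mistake_bound E R (@bandit_feedback X n) H L <= c%:E * ILdim E R H)%E.
  move=> fI redL; apply: ge_ereal_sup => _ [p [lp rp] <-].
  have [->|[d Hd]] := ILdim_infinite_or_nat R E H0.
    (* For infinite dimension the bound is vacuous once [c > 0]; the play supplies an instance,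
       hence [D > 0]. *)
    suff c_gt0 : 0 < c by rewrite gt0_muley ?leey// lte_fin.
    by rewrite /c !mulr_gt0// ltr0n (degree_gt0 (Exx (instance p 0))).
  rewrite Hd -EFinM; apply: num_mistakes_le => N; rewrite lee_fin.
  exact: isoa_mistakes_le Exx ED Hd fI redL lp rp.
split; first exact: upper.
have [f fI] := exists_isoa_implementation R E n.
have [L redL] := exists_reduction R E D (isoa f H).
have optL : (optimal_mistake_bound E R (@bandit_feedback X n) H <=
             mistake_bound E R (@bandit_feedback X n) H L)%E.
  by apply: ereal_inf_lbound; exists L.
(* The tree adversary needs an instance. Over an empty [X] there are no plays, and the mistake bound
   is the supremum of the empty set, [-oo]. *)
have [[x0 _]|noX] := pselect (exists x : X, True).
  apply: le_trans optL (le_trans (upper _ _ fI redL) _).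
  apply: lee_wpmul2l; first by rewrite lee_fin.
  by apply: le_ereal_inf_tmp => _ [L' _ <-]; exact: ILdim_le_mistake_bound.
apply: le_trans optL (le_trans _ (leNye _)).
by apply: ge_ereal_sup => _ [p _ <-]; case: noX; exists (instance p 0).
Qed.
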